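(* Let $n\in\mathbb{N}$ and let $\Psi\colon \mathcal{W}_2(\mathbb{S}^n,\|\cdot\|)\to\mathcal{W}_2(\mathbb{S}^n,\|\cdot\|)$ be an isometry. Then there exists an isometry $\psi\colon \mathbb{S}^n\to\mathbb{S}^n$ of $(\mathbb{S}^n,\|\cdot\|)$ such that $\Psi=\psi_\#$. (That is, the quadratic Wasserstein space $\mathcal{W}_2(\mathbb{S}^n,\|\cdot\|)$ is isometrically rigid.)
   Context: $\mathbb{N}=\{1,2,\dots\}$. $\mathbb{S}^n=\{x\in\mathbb{R}^{n+1} : \|x\|=1\}$ is the Euclidean unit sphere, equipped with the (chordal) distance $\|x-y\|$ inherited from the Euclidean norm of $\mathbb{R}^{n+1}$. The space $\mathcal{W}_2(\mathbb{S}^n,\|\cdot\|)$ is the set $\mathcal{P}(\mathbb{S}^n)$ of all Borel probability measures on $\mathbb{S}^n$ endowed with the metric $$d_{\mathcal{W}_2}(\mu,\nu)=\left(\inf_{\pi\in\Pi(\mu,\nu)}\iint_{\mathbb{S}^n\times\mathbb{S}^n}\|x-y\|^2\,\mathrm{d}\pi(x,y)\right)^{1/2},$$ where $\Pi(\mu,\nu)$ is the set of couplings of $\mu$ and $\nu$, i.e. Borel probability measures on $\mathbb{S}^n\times\mathbb{S}^n$ with first marginal $\mu$ and second marginal $\nu$. An isometry of a metric space is a surjective distance-preserving map from the space onto itself. The push-forward $\psi_\#$ of a Borel map $\psi\colon\mathbb{S}^n\to\mathbb{S}^n$ is given by $(\psi_\#\mu)(A)=\mu(\psi^{-1}[A])$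 for Borel sets $A\subseteq\mathbb{S}^n$. *)

(* Defs.v *)
From HB Require Import structures.
From mathcomp Require Import all_boot all_order all_algebra.
From mathcomp Require Import all_classical all_reals all_analysis.

Set Implicit Arguments.
Unset Strict Implicit.
Unset Printing Implicit Defensive.

Import Order.TTheory GRing.Theory Num.Theory.
Import numFieldTopology.Exports numFieldNormedType.Exports.

Local Open Scope classical_set_scope.
Local Open Scope ring_scope.

(* The library norm of 'rV[R]_m is the sup norm, hence a separate Euclidean
   norm. *)
Definition enorm (R : realType) (m : nat) (x : 'rV[R]_m) : R :=
  Num.sqrt (\sum_(i < m) x 0 i ^+ 2).

Definition sphere (R : realType) (n : nat) : Type :=
  set_type [set x : 'rV[R]_n.+1 | enorm x = 1].

Definition chordal (R : realType) (n : nat) (x y : sphere R n) : R :=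
  enorm (\val x - \val y).

Section sphere_structures.
Variables (R : realType) (n : nat).

Lemma enorm_delta0 : [set x : 'rV[R]_n.+1 | enorm x = 1] (delta_mx 0 0).
Proof.
rewrite /= /enorm (bigD1 ord0) //= big1 => [|i /negPf ni].
  by rewrite mxE !eqxx expr1n addr0 sqrtr1.
by rewrite mxE ni andbF expr0n.
Qed.

(* Subspace topology: the sup norm and the Euclidean norm induce the same
   topology on 'rV[R]_n.+1. *)
HB.instance Definition _ := Topological.on (sphere R n).
HB.instance Definition _ :=
  isPointed.Build (sphere R n) (SigSub (mem_set enorm_delta0)).

HB.instance Definition _ :=
  Measurable.copy (sphere R n) (g_sigma_algebraType (@open (sphere R n))).

End sphere_structures.

(* A library measure is a function on all subsets, with arbitrary values on the
   non-measurable ones. Setting these to 0 selects exactly one library measure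
   for each Borel probability measure, so that = is the equality of P(S^n). *)
Record borelProb (R : realType) (n : nat) : Type := BorelProb {
  borelProb_val :> probability (sphere R n) R ;
  borelProb_out : forall A : set (sphere R n),
    ~ measurable A -> borelProb_val A = 0%E
}.

Lemma borelProb_ext (R : realType) (n : nat) (mu nu : borelProb R n) :
  (forall A, measurable A -> mu A = nu A) -> mu = nu.
Proof.
case: mu nu => [mu mu0] [nu nu0] /= h.
suff e : mu = nu by subst nu; congr BorelProb; exact: Prop_irrelevance.
have efun : (mu : set (sphere R n) -> \bar R) = nu.
  apply/funext => A; have [mA|nA] := pselect (measurable A); first exact: h.
  by rewrite mu0 // nu0.
case: mu nu efun {mu0 nu0 h} => [f [[a1 a2] [b] [c] [d] [e] [p] [q]]].
case=> [g [[a1' a2'] [b'] [c'] [d'] [e'] [p'] [q']]] /= efun; subst g.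
by rewrite (Prop_irrelevance a1' a1) (Prop_irrelevance a2' a2)
  (Prop_irrelevance b' b) (Prop_irrelevance c' c) (Prop_irrelevance d' d)
  (Prop_irrelevance e' e) (Prop_irrelevance p' p) (Prop_irrelevance q' q).
Qed.

Section borelProb_of.
Variables (R : realType) (n : nat) (mu : probability (sphere R n) R).

Definition trim (A : set (sphere R n)) : \bar R :=
  if pselect (measurable A) then mu A else 0%E.

Lemma trimE A : measurable A -> trim A = mu A.
Proof. by rewrite /trim; case: pselect. Qed.

Let trim0 : trim set0 = 0%E.
Proof. by rewrite trimE // measure0. Qed.

Let trim_ge0 A : (0 <= trim A)%E.
Proof. by rewrite /trim; case: pselect => mA /=; rewrite ?measure_ge0. Qed.

Let trim_sigma_additive : semi_sigma_additive trim.
Proof.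
move=> F mF tF mUF; rewrite trimE //.
have -> : (fun k => \sum_(0 <= i < k) trim (F i))%E =
          (fun k => \sum_(0 <= i < k) mu (F i))%E.
  by apply/funext => k; apply: eq_bigr => i _; rewrite trimE.
exact: measure_semi_sigma_additive.
Qed.

HB.instance Definition _ :=
  isMeasure.Build _ _ _ trim trim0 trim_ge0 trim_sigma_additive.

Let trimT : trim setT = 1%E.
Proof. by rewrite trimE // probability_setT. Qed.

HB.instance Definition _ := Measure_isProbability.Build _ _ _ trim trimT.

Let trim_out A : ~ measurable A -> trim A = 0%E.
Proof. by rewrite /trim; case: pselect. Qed.

Definition borelProb_of : borelProb R n :=
  @BorelProb R n (trim : probability _ _) trim_out.

Lemma borelProb_ofE A : measurable A -> borelProb_of A = mu A.
Proof. exact: trimE. Qed.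

End borelProb_of.

(* The product sigma-algebra on S^n * S^n is its Borel sigma-algebra, because
   S^n is second countable. *)
Definition couplings (R : realType) (n : nat) (mu nu : borelProb R n) :
    set (probability (sphere R n * sphere R n)%type R) :=
  [set pi | forall A : set (sphere R n), measurable A ->
     pi (fst @^-1` A) = mu A /\ pi (snd @^-1` A) = nu A].

(* The infimum lies in [0, 4]: the product measure is a coupling, and the
   integrand is at most 4. Hence fine does not alter it. *)
Definition W2 (R : realType) (n : nat) (mu nu : borelProb R n) : R :=
  Num.sqrt (fine (ereal_inf
    [set (\int[pi]_z ((chordal z.1 z.2) ^+ 2)%:E)%E | pi in couplings mu nu])).

Definition is_isometry (R : realType) (T : Type) (d : T -> T -> R) (f : T -> T) :
    Prop :=
  (forall y, exists x, f x = y) /\ (forall x y, d (f x) (f y) = d x y).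

(* Main.v *)
From HB Require Import structures.
Require Import Defs.
From mathcomp Require Import all_boot all_order all_algebra.
From mathcomp Require Import all_classical all_reals all_analysis.
From mathcomp Require Import measurable_realfun.
From mathcomp Require Import ring lra.

Set Implicit Arguments.
Unset Strict Implicit.
Unset Printing Implicit Defensive.

Import Order.TTheory GRing.Theory Num.Theory.
Import numFieldTopology.Exports numFieldNormedType.Exports.

Local Open Scope classical_set_scope.
Local Open Scope ring_scope.

(** Point masses are recognisable metrically: the cost is at most 4, with
    equality only for antipodal points, so W2 mu nu = 2 forces the product
    coupling to live on pairs (x, -x), and both measures are point masses
    ([W2_eq2_point_mass]). Hence Psi maps point masses to point masses, through
    a surjective isometry psi of the sphere.

    To see that Psi mu is the push-forward of mu by psi, consider, for a point x
    and 0 < r < 1, the functional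
       eta |-> W2 mu eta ^+ 2 + r * W2 (point_mass x) eta ^+ 2.
    Since |y - z|^2 + r |x - z|^2 = 2 + 2r - 2 <y + r x, z> for unit vectors,
    the best partner of y is z = (y + r x) / |y + r x|, and the minimum of the
    functional is 2 + 2r - 2 * (the integral of |y + r x| against mu)
    ([weighted_W2_ge], [weighted_W2_attained]). An isometry preserves such a
    minimum, so the integral of |y + r x| against mu equals that of
    |y + r psi x| against Psi mu. Consequently Psi mu and the push-forward of mu
    give the same integral to y |-> |y + r z|, for every z on the sphere and
    0 < r < 1.

    It remains to see that these integrals determine a measure
    ([sphere_measure_determined]). Up to a factor, |y + r z| is
    sqrt (1 + c <z, y>) with c = 2r / (1 + r^2). As all Taylor coefficients of
    sqrt at 1 are nonzero, letting c tend to 0 recovers, one degree after the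
    other, the integrals of <z, y>^k ([agree_moment]). Summing exponential
    series gives the integrals of exp <w, y>, then those of
    exp (- sum_i exp (k^2 (y_i - a_i) + k)); as k grows these functions tend to
    the indicator of the box of all y with y_i < a_i for every i, and such boxes
    form a pi-system generating the Borel sets. *)

(** * Functions with equal integrals against two probability measures *)

Section bounded_measurable.
Context d {T : measurableType d} {R : realType}.
Implicit Types (P : probability T R) (f g : T -> R).

Definition bmeas f :=
  measurable_fun setT f /\ exists M : R, forall x, `|f x| <= M.

Lemma bmeas_integrable P f : bmeas f -> P.-integrable setT (EFin \o f).
Proof.
move=> [mf [M fM]]; apply: measurable_bounded_integrable => //.
  by rewrite -ge0_fin_numE ?measure_ge0 //; exact: fin_num_measure.
exists M; split=> [|N MN x _]; first exact: num_real.
exact: le_trans (fM x) (ltW MN).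
Qed.

Lemma bmeas_integralE P f : bmeas f ->
  (\int[P]_x (f x)%:E)%E = (\int[P]_x f x)%:E.
Proof.
move=> bf; rewrite /Rintegral fineK //.
exact: integrable_fin_num (bmeas_integrable P bf).
Qed.

Lemma bmeas_cst a : bmeas (fun=> a).
Proof. by split; [exact: measurable_cst|exists `|a|]. Qed.

Lemma bmeasD f g : bmeas f -> bmeas g -> bmeas (fun x => f x + g x).
Proof.
move=> [mf [M fM]] [mg [N gN]]; split; first exact: measurable_funD.
by exists (M + N) => x; rewrite (le_trans (ler_normD _ _))// lerD.
Qed.

Lemma bmeasM f g : bmeas f -> bmeas g -> bmeas (fun x => f x * g x).
Proof.
move=> [mf [M fM]] [mg [N gN]]; split; first exact: measurable_funM.
by exists (M * N) => x; rewrite normrM ler_pM.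
Qed.

Lemma bmeasZ a f : bmeas f -> bmeas (fun x => a * f x).
Proof. by apply: bmeasM; exact: bmeas_cst. Qed.

Lemma mean_cst P a : \int[P]_x (fun=> a) x = a.
Proof. by rewrite Rintegral_cst //= probability_setT mulr1. Qed.

End bounded_measurable.

Section agreement.
Context d {T : measurableType d} {R : realType}.
Variables P Q : probability T R.
Implicit Types f g : T -> R.

Definition agree f := bmeas f /\ \int[P]_x f x = \int[Q]_x f x.

Lemma agree_cst a : agree (fun=> a).
Proof. by split; [exact: bmeas_cst|rewrite !mean_cst]. Qed.

Lemma agreeD f g : agree f -> agree g -> agree (fun x => f x + g x).
Proof.
move=> [bf ef] [bg eg]; split; first exact: bmeasD.
by rewrite !RintegralD// ?ef ?eg//; exact: bmeas_integrable.
Qed.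

Lemma agreeZ a f : agree f -> agree (fun x => a * f x).
Proof.
move=> [bf ef]; split; first exact: bmeasZ.
by rewrite !RintegralZl// ?ef//; exact: bmeas_integrable.
Qed.

Lemma agree_ext f g : f =1 g -> agree f -> agree g.
Proof. by move=> /funext ->. Qed.

Lemma agreeB f g : agree f -> agree g -> agree (fun x => f x - g x).
Proof.
move=> af /(agreeZ (-1)) ag; apply: agree_ext (agreeD af ag) => x /=.
by rewrite mulN1r.
Qed.

Lemma agree_sum (I : Type) (r : seq I) (p : pred I) (F : I -> T -> R) :
  (forall i, p i -> agree (F i)) -> agree (fun x => \sum_(i <- r | p i) F i x).
Proof.
move=> aF; elim: r => [|i r IH].
  by apply: agree_ext (agree_cst 0) => x; rewrite big_nil.
case pi: (p i); last by apply: agree_ext IH => x; rewrite big_cons pi.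
by apply: agree_ext (agreeD (aF i pi) IH) => x; rewrite big_cons pi.
Qed.

(** Bounded convergence; it is what turns the families of functions known to
    [agree] into larger ones. *)
Lemma agree_lim (F : nat -> T -> R) f (M : R) :
  (forall k, agree (F k)) -> (forall k x, `|F k x| <= M) ->
  (forall x, F k x @[k --> \oo] --> f x) -> agree f.
Proof.
move=> aF FM Ff.
have mf : measurable_fun setT f.
  apply: (@measurable_fun_cvg _ _ _ _ F) => [k|x _]; last exact: Ff.
  by have [[]] := aF k.
have bf : bmeas f.
  split=> //; exists M => x.
  have /(cvg_norm) /= h := Ff x.
  by apply: (cvgr_to_le h); apply: nearW => k; exact: FM.
have dom (S : probability T R) :
    (\int[S]_x (F k x)%:E)%E @[k --> \oo] --> (\int[S]_x (f x)%:E)%E.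
  have [] // := @dominated_convergence _ T R S setT measurableT
    (fun k x => (F k x)%:E) (fun x => (f x)%:E) (fun=> M%:E).
  - by move=> k; apply/measurable_EFinP; have [[]] := aF k.
  - exact/measurable_EFinP.
  - by apply: aeW => x _; apply/fine_cvgP; split; [exact: nearW|exact: Ff].
  - exact: (bmeas_integrable _ (bmeas_cst M)).
  - by apply: aeW => x k _; rewrite lee_fin.
split=> //; rewrite /Rintegral; congr fine.
apply: cvg_unique (dom P) _ => //.
rewrite (_ : (fun k => _) = (fun k => (\int[Q]_x (F k x)%:E)%E)).
  exact: dom.
apply/funext => k; have [bk ek] := aF k.
by rewrite !bmeas_integralE // ek.
Qed.

(** The partial sums of the exponential series of [g] are polynomials in [g],
    and they are bounded by [expR M] when [M] bounds [g]. *)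
Lemma agree_expR g : (forall j, agree (fun x => g x ^+ j)) ->
  agree (fun x => expR (g x)).
Proof.
move=> ag; have [[_ [M gM]] _] := ag 1%N.
have M0 (x : T) : 0 <= M by exact: le_trans (gM x).
apply: (@agree_lim (fun k x => series (exp_coeff (g x)) k) _ (expR M)).
- move=> k; rewrite /series /=; apply: agree_sum => j _.
  rewrite /exp_coeff /=.
  by apply: agree_ext (agreeZ (j`!%:R^-1) (ag j)) => x; rewrite mulrC.
- move=> k x; rewrite /series /=.
  apply: (le_trans (ler_norm_sum _ _ _)).
  apply: (@le_trans _ _ (series (exp_coeff M) k)).
    apply: ler_sum => j _; rewrite /exp_coeff /= normrM normrX.
    rewrite [X in _ * X]ger0_norm ?invr_ge0 ?ler0n //.
    apply: ler_wpM2r; first by rewrite invr_ge0 ler0n.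
    by apply: lerXn2r; rewrite ?nnegrE ?normr_ge0 ?(M0 x) //; exact: (gM x).
  apply: nondecreasing_cvgn_le; last exact: is_cvg_series_exp_coeff.
  apply/nondecreasing_seqP => n; rewrite /series /= big_nat_recr //= lerDl.
  exact/exp_coeff_ge0/(M0 x).
- move=> x; exact: is_cvg_series_exp_coeff.
Qed.

End agreement.

(** * Recovering moments from square roots *)

Section sqrt_polynomial.
Variable R : realType.

(** The function f(t) = 1 - sqrt (1 - t) satisfies f = (t + f^2) / 2, and
    iterating this equation from 0 gains one order of accuracy at 0 at each
    step. These iterates replace Taylor polynomials: their degree exceeds their
    accuracy in general, but their coefficients are evidently nonnegative. *)
Fixpoint sqrtpoly (k : nat) : {poly R} :=
  if k is k'.+1 then 2^-1 *: ('X + sqrtpoly k' ^+ 2) else 0.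

Lemma sqrtpoly_ge0 k i : 0 <= (sqrtpoly k)`_i.
Proof.
elim: k i => [|k IH] i /=; first by rewrite coef0.
rewrite coefZ coefD coefX mulr_ge0 ?invr_ge0// addr_ge0//.
by rewrite expr2 coefM sumr_ge0// => j _; rewrite mulr_ge0.
Qed.

(** The term of index 1 of the convolution giving the coefficient [k.+2] of the
    square is a product of two positive coefficients. *)
Lemma sqrtpoly_gt0 k : 0 < (sqrtpoly k.+1)`_k.+1.
Proof.
have cE j i : (sqrtpoly j.+1)`_i =
    2^-1 * ((i == 1%N)%:R +
      \sum_(l < i.+1) (sqrtpoly j)`_l * (sqrtpoly j)`_(i - l)).
  by rewrite /= coefZ coefD coefX expr2 coefM.
have s_ge0 j i : 0 <= \sum_(l < i.+1) (sqrtpoly j)`_l * (sqrtpoly j)`_(i - l).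
  by apply: sumr_ge0 => l _; rewrite mulr_ge0 ?sqrtpoly_ge0.
have c1 j : 0 < (sqrtpoly j.+1)`_1.
  by rewrite cE mulr_gt0 ?invr_gt0// ltr_pwDl// ltr01.
elim: k => [|k IH]; first exact: (c1 0%N).
rewrite cE mulr_gt0 ?invr_gt0// ltr_wpDl//.
have l1 : (1 < k.+3)%N by [].
rewrite (bigD1 (Ordinal l1)) //= ltr_pwDl //.
  by rewrite subSS subn0 mulr_gt0// c1.
by apply: sumr_ge0 => l _; rewrite mulr_ge0 ?(sqrtpoly_ge0 k.+1)//.
Qed.

(** If f - b = O(t^(k+1)), then f^2 - b^2 = (f - b) (f + b) is O(t^(k+2)). *)
Lemma sqrtpoly_approx k : exists2 C : R, 0 <= C & forall t : R, `|t| <= 1 ->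
  `|1 - Num.sqrt (1 - t) - (sqrtpoly k).[t]| <= C * `|t| ^+ k.+1.
Proof.
pose f (t : R) := 1 - Num.sqrt (1 - t).
have sq (t : R) : `|t| <= 1 -> (Num.sqrt (1 - t)) ^+ 2 = 1 - t.
  by move=> /ler_normlP [? t1]; rewrite sqr_sqrtr// subr_ge0.
have f1 (t : R) : `|t| <= 1 -> `|f t| <= `|t|.
  move=> t1; have /(congr1 Num.norm) : f t * (1 + Num.sqrt (1 - t)) = t.
    rewrite /f (_ : _ * _ = 1 - Num.sqrt (1 - t) ^+ 2); last by ring.
    by rewrite sq//; ring.
  rewrite normrM => <-; rewrite ler_peMr//.
  by rewrite ger0_norm ?lerDl ?addr_ge0 ?sqrtr_ge0.
elim: k => [|k [C C0 IH]].
  by exists 1 => // t t1; rewrite /= horner0 subr0 mul1r; exact: f1.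
exists (2^-1 * (C * (2 + C))).
  by rewrite !mulr_ge0 ?invr_ge0 ?addr_ge0.
move=> t t1; have := IH t t1; rewrite -/(f t) => {}IH.
set b := (sqrtpoly k).[t] in IH.
have -> : f t - (sqrtpoly k.+1).[t] = 2^-1 * ((f t - b) * (f t + b)).
  rewrite /= hornerZ hornerD hornerX horner_exp -/b.
  have : f t = 2^-1 * (t + f t ^+ 2).
    have := sq t t1; rewrite /f; set s := Num.sqrt _ => es.
    have -> : t = 1 - s ^+ 2 by rewrite es; ring.
    by field.
  by move=> {1}->; field.
rewrite normrM ger0_norm ?invr_ge0// -!mulrA ler_wpM2l ?invr_ge0//.
rewrite normrM (_ : C * _ = (C * `|t| ^+ k.+1) * ((2 + C) * `|t|)); last first.
  by rewrite [in LHS]exprSr; ring.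
apply: ler_pM => //.
have -> : f t + b = 2 * f t - (f t - b) by ring.
apply: (le_trans (ler_normB _ _)); rewrite [leRHS]mulrDl; apply: lerD.
  by rewrite normrM ger0_norm// ler_wpM2l// f1.
apply: (le_trans IH); rewrite ler_wpM2l// exprS ler_piMr//.
exact: exprn_ile1.
Qed.

Lemma horner_split_at (p : {poly R}) k : exists q : {poly R}, forall t : R,
  p.[t] = \sum_(j < k) p`_j * t ^+ j + p`_k * t ^+ k + t ^+ k.+1 * q.[t].
Proof.
exists (drop_poly k.+1 p) => t.
rewrite -{1}(poly_take_drop k.+1 p) hornerD hornerM hornerXn.
rewrite [_ * t ^+ _]mulrC; congr (_ + _).
by rewrite /take_poly horner_poly big_ord_recr.
Qed.

Lemma horner_bounded (p : {poly R}) :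
  exists2 K : R, 0 <= K & forall t : R, `|t| <= 1 -> `|p.[t]| <= K.
Proof.
exists (\sum_(i < size p) `|p`_i|); first exact: sumr_ge0.
move=> t t1; rewrite horner_coef (le_trans (ler_norm_sum _ _ _))//.
apply: ler_sum => i _; rewrite normrM ler_piMr// normrX.
exact: exprn_ile1.
Qed.

End sqrt_polynomial.

Section moments.
Context d {T : measurableType d} {R : realType}.
Variables P Q : probability T R.

(** By induction, the moments of degree at most [k] are known. Subtract the
    corresponding terms of the expansion of 1 - sqrt (1 - c u) and divide by
    c^(k+1): what is left is a positive multiple of u^(k+1) up to O(c). *)
Lemma agree_moment (u : T -> R) (c : nat -> R) :
  (forall x, `|u x| <= 1) -> (forall i, 0 < c i <= 1) -> c @ \oo --> 0 ->
  (forall i, agree P Q (fun x => Num.sqrt (1 - c i * u x))) ->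
  forall k, agree P Q (fun x => u x ^+ k).
Proof.
move=> u1 c01 c0 asq k.
have [n] := ubnP k; elim: n k => // n IH [|k] kn.
  by apply: agree_ext (agree_cst P Q 1) => x; rewrite expr0.
have c_gt0 i : 0 < c i by have /andP[] := c01 i.
have cu1 i x : `|c i * u x| <= 1.
  have /andP[? ?] := c01 i.
  by rewrite normrM mulr_ile1// ger0_norm// ltW.
have [C C0 HC] := sqrtpoly_approx R k.+1.
pose p := sqrtpoly R k.+1; pose b := p`_k.+1.
have b0 : 0 < b by exact: sqrtpoly_gt0.
have [q pq] := horner_split_at p k.+1.
have [K K0 HK] := horner_bounded q.
pose F i x := (b * c i ^+ k.+1)^-1 *
   (1 - Num.sqrt (1 - c i * u x) - \sum_(j < k.+1) p`_j * (c i * u x) ^+ j).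
pose M := b^-1 * (C + K).
have M0 : 0 <= M by rewrite mulr_ge0 ?invr_ge0 ?addr_ge0// ltW.
(* The error is the remainder of [sqrtpoly_approx] plus the tail of [p]. *)
have FuM i x : `|F i x - u x ^+ k.+1| <= M * c i.
  have ci := c_gt0 i.
  have -> : F i x - u x ^+ k.+1 = (b * c i ^+ k.+1)^-1 *
      ((1 - Num.sqrt (1 - c i * u x) - p.[c i * u x])
       + (c i * u x) ^+ k.+2 * q.[c i * u x]).
    rewrite /F pq -/b (exprMn k.+1 (c i) (u x)).
    set A := Num.sqrt _; set B := \sum_(j < _) _; set D := q.[_].
    set e := c i ^+ k.+1; have e0 : e != 0 by rewrite expf_neq0// gt_eqF.
    have bn0 : b != 0 by rewrite gt_eqF.
    by field; rewrite ?e0.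
  rewrite normrM ger0_norm; last first.
    by rewrite invr_ge0 mulr_ge0// ?exprn_ge0// ltW.
  rewrite invfM /M -[leLHS]mulrA -[leRHS]mulrA ler_wpM2l//.
    by rewrite invr_ge0 ltW.
  rewrite mulrC ler_pdivrMr ?exprn_gt0//.
  rewrite -[leRHS]mulrA -[in leRHS]exprS [leRHS]mulrDl.
  have cuk : `|c i * u x| ^+ k.+2 <= c i ^+ k.+2.
    have ci0 := ltW ci.
    apply: lerXn2r; rewrite ?nnegrE ?normr_ge0//.
    by rewrite normrM ger0_norm// ler_piMr.
  apply: (le_trans (ler_normD _ _)); apply: lerD.
    by apply: (le_trans (HC _ (cu1 i x))); rewrite ler_wpM2l.
  by rewrite normrM normrX mulrC ler_pM// HK.
apply: (@agree_lim _ _ _ _ _ F _ (M + 1)).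
- move=> i; apply: agreeZ; apply: agreeB.
    by apply: agreeB; [exact: agree_cst|exact: asq].
  apply: agree_sum => j _.
  apply: agree_ext (agreeZ (p`_j * c i ^+ j) (IH j _)) => [x|].
    by rewrite exprMn mulrA.
  by rewrite (leq_trans (ltn_ord j)).
- move=> i x; rewrite -(subrK (u x ^+ k.+1) (F i x)).
  apply: (le_trans (ler_normD _ _)); apply: lerD.
    apply: (le_trans (FuM i x)); rewrite ler_piMr//.
    by have /andP[] := c01 i.
  by rewrite normrX exprn_ile1.
- move=> x; apply/cvgrPdist_le => e e0.
  have Mc0 : M * c i @[i --> \oo] --> 0.
    by rewrite -(mulr0 M); apply: cvgMr.
  move/cvgrPdist_le: Mc0 => /(_ e e0).
  apply: filterS => i; rewrite sub0r normrN distrC => Mce.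
  apply: (le_trans (FuM i x)); apply: le_trans Mce.
  exact: ler_norm.
Qed.

End moments.

(** * Euclidean geometry of the sphere *)

Section dot_product.
Variables (R : realType) (m : nat).
Implicit Types u v w : 'rV[R]_m.

Definition dot u v : R := \sum_(i < m) u 0 i * v 0 i.

Lemma dotC u v : dot u v = dot v u.
Proof. by apply: eq_bigr => i _; rewrite mulrC. Qed.

Lemma dotDl u v w : dot (u + v) w = dot u w + dot v w.
Proof.
by rewrite /dot -big_split; apply: eq_bigr => i _; rewrite mxE mulrDl.
Qed.

Lemma dotZl a u v : dot (a *: u) v = a * dot u v.
Proof. by rewrite /dot mulr_sumr; apply: eq_bigr => i _; rewrite mxE mulrA. Qed.

Lemma dot0l v : dot 0 v = 0.
Proof. by rewrite -(scale0r 0) dotZl mul0r. Qed.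

Lemma dotDr u v w : dot u (v + w) = dot u v + dot u w.
Proof. by rewrite dotC dotDl !(dotC u). Qed.

Lemma dotZr a u v : dot u (a *: v) = a * dot u v.
Proof. by rewrite dotC dotZl dotC. Qed.

Lemma dot_ge0 u : 0 <= dot u u.
Proof. by apply: sumr_ge0 => i _; rewrite -expr2 sqr_ge0. Qed.

Lemma dot_eq0 u : dot u u = 0 -> u = 0.
Proof.
move=> /eqP; rewrite psumr_eq0 => [/allP u0|i _]; last first.
  by rewrite -expr2 sqr_ge0.
apply/rowP => i; rewrite mxE; apply/eqP; rewrite -sqrf_eq0 expr2.
by apply: u0; rewrite mem_index_enum.
Qed.

Lemma enormE u : enorm u = Num.sqrt (dot u u).
Proof. by congr Num.sqrt; apply: eq_bigr => i _; rewrite expr2. Qed.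

Lemma enorm_ge0 u : 0 <= enorm u. Proof. exact: sqrtr_ge0. Qed.

Lemma enorm_sqr u : enorm u ^+ 2 = dot u u.
Proof. by rewrite enormE sqr_sqrtr// dot_ge0. Qed.

Lemma enorm_eq0 u : enorm u = 0 -> u = 0.
Proof. by move=> u0; apply: dot_eq0; rewrite -enorm_sqr u0 expr0n. Qed.

End dot_product.

Section sphere_geometry.
Variables (R : realType) (n : nat).
Local Notation S := (sphere R n).
Implicit Types x y z : S.

Definition sdot x y : R := dot (\val x) (\val y).

Lemma sdotC x y : sdot x y = sdot y x. Proof. exact: dotC. Qed.

Lemma sdot_id x : sdot x x = 1.
Proof.
by rewrite /sdot -enorm_sqr; case: x => x /= /set_mem /= ->; rewrite expr1n.
Qed.

Lemma chordal_ge0 x y : 0 <= chordal x y. Proof. exact: enorm_ge0. Qed.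

Lemma chordal_sqr x y : chordal x y ^+ 2 = 2 - 2 * sdot x y.
Proof.
rewrite enorm_sqr -scaleN1r dotDl !dotDr !dotZl !dotZr.
have := sdot_id x; have := sdot_id y; rewrite /sdot => -> ->.
by rewrite (dotC (\val y)); ring.
Qed.

(** The unit vector u / |u|, with an arbitrary value at 0. *)
Definition sdir (u : 'rV[R]_n.+1) : S :=
  insubd ((point : S) : set_type [set x : 'rV[R]_n.+1 | enorm x = 1])
    ((enorm u)^-1 *: u).

Lemma sdirE (u : 'rV[R]_n.+1) : enorm u != 0 -> enorm u *: \val (sdir u) = u.
Proof.
move=> u0; rewrite val_insubd mem_set /=.
  by rewrite scalerA divff// scale1r.
rewrite enormE dotZl dotZr -enorm_sqr mulrA -expr2 -exprMn mulVf//.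
by rewrite expr1n sqrtr1.
Qed.

(** Cauchy-Schwarz, read off from 0 <= |u / |u| - z|^2. *)
Lemma dot_le_enorm (u : 'rV[R]_n.+1) z : dot u (\val z) <= enorm u.
Proof.
have [u0|u0] := eqVneq (enorm u) 0.
  by rewrite u0 (enorm_eq0 u0) dot0l.
rewrite -[leRHS]mulr1 -{1}(sdirE u0) dotZl -/(sdot _ _) ler_wpM2l ?enorm_ge0//.
by have := sqr_ge0 (chordal (sdir u) z); rewrite chordal_sqr; lra.
Qed.

Definition sopp x : S := sdir (- \val x).

Lemma val_sopp x : \val (sopp x) = - \val x.
Proof.
have e1 : enorm (- \val x) = 1.
  rewrite enormE -scaleN1r dotZl dotZr -/(sdot x x) sdot_id.
  by rewrite !mulN1r opprK sqrtr1.
by have := @sdirE (- \val x); rewrite e1 scale1r => ->//; exact: oner_neq0.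
Qed.

Lemma soppK x : sopp (sopp x) = x.
Proof. by apply: val_inj; rewrite !val_sopp opprK. Qed.

Lemma sdotNl x y : sdot (sopp x) y = - sdot x y.
Proof. by rewrite /sdot val_sopp -scaleN1r dotZl mulN1r. Qed.

Lemma norm_sdot_le1 x y : `|sdot x y| <= 1.
Proof.
have := sqr_ge0 (chordal x y); have := sqr_ge0 (chordal (sopp x) y).
rewrite !chordal_sqr sdotNl => ? ?.
by rewrite ler_norml; apply/andP; split; lra.
Qed.

Lemma sdot_eq1 x y : sdot x y = 1 -> x = y.
Proof.
move=> xy; apply/val_inj/eqP; rewrite -subr_eq0; apply/eqP/enorm_eq0/eqP.
by rewrite -sqrf_eq0 -/(chordal x y) chordal_sqr xy mulr1 subrr.
Qed.

Lemma sdot_eqN1 x y : sdot x y = -1 -> y = sopp x.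
Proof. by move=> xy; apply/esym/sdot_eq1; rewrite sdotNl xy opprK. Qed.

Lemma coord_le1 y i : `|\val y 0 i| <= 1.
Proof.
rewrite -(@expr_le1 _ 2)// real_normK ?num_real//.
suff : \val y 0 i ^+ 2 <= sdot y y by rewrite sdot_id.
rewrite /sdot /dot (bigD1 i)//= -expr2 lerDl.
by apply: sumr_ge0 => j _; rewrite -expr2 sqr_ge0.
Qed.

End sphere_geometry.

(** * A generating pi-system of the Borel sets of the sphere *)

Section sphere_borel.
Variables (R : realType) (n : nat).
Local Notation S := (sphere R n).

Definition box (a : 'rV[R]_n.+1) : set S :=
  [set y : S | forall i, \val y 0 i < a 0 i].

Lemma open_coord_lt i (a : R) : open [set y : S | \val y 0 i < a].
Proof.
exists [set u : 'rV[R]_n.+1 | u 0 i < a] => //.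
rewrite (_ : mkset _ = (fun u : 'rV[R]_n.+1 => u 0 i) @^-1` [set x | x < a])//.
by apply: open_comp => [u _|]; [exact: coord_continuous|exact: open_lt].
Qed.

Lemma setI_closed_box : setI_closed (range box).
Proof.
move=> _ _ [a _ <-] [b _ <-].
exists (\row_i Num.min (a 0 i) (b 0 i)) => //.
apply/seteqP; split=> y /=.
  by move=> yab; split=> i; have := yab i; rewrite mxE lt_min => /andP[].
by move=> [ya yb] i; rewrite mxE lt_min ya yb.
Qed.

Lemma box2 : box (const_mx 2) = setT.
Proof.
apply/seteqP; split=> // y _ i; rewrite mxE.
have /ler_normlP[_ yi] := coord_le1 y i.
by apply: (le_lt_trans yi); rewrite ltr1n.
Qed.

Let T := g_sigma_algebraType (range box).

(* As coordinates are at most 1, the bound 2 leaves the others free. *)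
Let box_coord_lt i (a : R) : @measurable _ T [set y : S | \val y 0 i < a].
Proof.
apply: sub_sigma_algebra; exists (\row_j if j == i then a else 2) => //.
apply/seteqP; split=> y /=.
  by move=> /(_ i); rewrite mxE eqxx.
move=> yi j; rewrite mxE; case: eqVneq => [->//|_].
have /ler_normlP[_ yj] := coord_le1 y j.
by apply: (le_lt_trans yj); rewrite ltr1n.
Qed.

Let measurable_coord_box i :
  measurable_fun [set: T] (fun y : T => \val (y : S) 0 i).
Proof.
apply: (measurability _ (RGenInftyO.measurableE R)) => _ [_ [a ->] <-].
rewrite setTI (_ : _ @^-1` _ = [set y : S | \val y 0 i < a]).
  exact: box_coord_lt.
by apply/seteqP; split=> y /=; rewrite in_itv.
Qed.

Lemma measurable_coord i : measurable_fun [set: S] (fun y : S => \val y 0 i).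
Proof.
apply: (measurability _ (RGenInftyO.measurableE R)) => _ [_ [a ->] <-].
rewrite setTI (_ : _ @^-1` _ = [set y : S | \val y 0 i < a]).
  by apply: sub_sigma_algebra; exact: open_coord_lt.
by apply/seteqP; split=> y /=; rewrite in_itv.
Qed.

Let box_itv (q r : 'rV[R]_n.+1) :
  @measurable _ T [set y : S | forall i, q 0 i < \val y 0 i < r 0 i].
Proof.
rewrite (_ : mkset _ = \bigcap_(i in [set: 'I_n.+1])
    ((fun y : T => \val (y : S) 0 i) @^-1` `]q 0 i, r 0 i[%classic)).
  apply: fin_bigcap_measurable => [|i _]; first exact: finite_finset.
  by rewrite -[X in measurable X]setTI; apply: measurable_coord_box.
apply/seteqP; split=> y /=; first by move=> yqr i _ /=; rewrite in_itv/= yqr.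
by move=> yqr i; have := yqr i I; rewrite /= in_itv.
Qed.

(** Open boxes with rational vertices form a countable basis of the topology. *)
Let box_open (U : set S) : open U -> @measurable _ T U.
Proof.
move=> [V oV <-].
pose B (qr : 'rV[rat]_n.+1 * 'rV[rat]_n.+1) (y : 'rV[R]_n.+1) :=
  forall i, ratr (qr.1 0 i) < y 0 i < ratr (qr.2 0 i).
pose A qr : set T := if pselect (B qr `<=` V) then [set y : S | B qr (\val y)]
  else set0.
rewrite (_ : _ @^-1` V = \bigcup_qr A qr).
  apply: countable_bigcupT_measurable => [|qr]; first exact: countableP.
  rewrite /A; case: pselect => //= _.
  have := box_itv (map_mx ratr qr.1) (map_mx ratr qr.2).
  rewrite (_ : mkset _ = [set y : S | B qr (\val y)])//.
  apply/seteqP; split=> y /= By i; have := By i; first by rewrite !mxE.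
  by rewrite !mxE.
apply/seteqP; split=> y /=; last first.
  by move=> [qr _]; rewrite /A; case: pselect => //= BV /BV.
move=> Vy; have /nbhs_ballP[e /= e0 yeV] : nbhs (\val y) V.
  by move: oV; rewrite openE => /(_ _ Vy).
have lo i : exists q : rat, \val y 0 i - e < ratr q < \val y 0 i.
  have /rat_in_itvoo[q] : \val y 0 i - e < \val y 0 i by rewrite ltrBlDr ltrDl.
  by rewrite in_itv => ?; exists q.
have hi i : exists q : rat, \val y 0 i < ratr q < \val y 0 i + e.
  have /rat_in_itvoo[q] : \val y 0 i < \val y 0 i + e by rewrite ltrDl.
  by rewrite in_itv => ?; exists q.
have [q qP] := choice lo; have [r rP] := choice hi.
exists (\row_i q i, \row_i r i) => //; rewrite /A.
case: pselect => [_|]/=; last first.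
  case=> z Bz; apply: yeV; split=> // i j; rewrite ord1.
  have := Bz j; rewrite !mxE /ball /= => /andP[zq zr].
  have /andP[? ?] := qP j; have /andP[? ?] := rP j.
  by rewrite ltr_norml; apply/andP; split; lra.
move=> i; rewrite !mxE.
by have /andP[_ ->] := qP i; have /andP[-> _] := rP i.
Qed.

Lemma sphere_measurableE : @measurable _ S = <<s range box >>.
Proof.
apply/seteqP; split.
  apply: smallest_sub => [|U]; last exact: box_open.
  exact: smallest_sigma_algebra.
apply: smallest_sub; first exact: sigma_algebra_measurable.
move=> _ [a _ <-].
rewrite (_ : box a =
    \bigcap_(i in [set: 'I_n.+1]) [set y : S | \val y 0 i < a 0 i]).
  apply: fin_bigcap_measurable => [|i _]; first exact: finite_finset.
  by apply: sub_sigma_algebra; exact: open_coord_lt.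
by apply/seteqP; split=> y /= ya i => [_|]; exact: ya.
Qed.

End sphere_borel.

Section sphere_measurable_maps.
Variables (R : realType) (n : nat).
Local Notation S := (sphere R n).

Lemma sphere_measure_unique (P Q : probability S R) :
  (forall a, P (box a) = Q (box a)) ->
  forall A, measurable A -> P A = Q A.
Proof.
move=> PQ A mA.
apply: (measure_unique (range (@box R n)) (fun=> setT)) => //.
- exact: sphere_measurableE.
- exact: setI_closed_box.
- by move=> _; exists (const_mx 2) => //; exact: box2.
- by rewrite bigcup_const.
- by move=> _ [a _ <-]; exact: PQ.
- by move=> _; rewrite -ge0_fin_numE ?measure_ge0 //; exact: fin_num_measure.
Qed.

Lemma measurable_fun_sphere d (T : measurableType d) (f : T -> S) :
  (forall i, measurable_fun setT (fun t => \val (f t) 0 i)) ->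
  measurable_fun setT f.
Proof.
move=> mf; apply: (measurability _ (@sphere_measurableE R n)).
move=> _ [_ [a _ <-] <-]; rewrite setTI.
rewrite (_ : _ @^-1` _ = \bigcap_(i in [set: 'I_n.+1])
    ((fun t => \val (f t) 0 i) @^-1` `]-oo, a 0 i[%classic)).
  apply: fin_bigcap_measurable => [|i _]; first exact: finite_finset.
  by rewrite -[X in measurable X]setTI; apply: mf.
apply/seteqP; split=> t /=.
  by move=> ta i _ /=; rewrite in_itv/=; exact: ta.
by move=> ta i; have := ta i I; rewrite /= in_itv.
Qed.

Lemma measurable_sdot d (T : measurableType d) (f g : T -> S) :
  measurable_fun setT f -> measurable_fun setT g ->
  measurable_fun setT (fun t => sdot (f t) (g t)).
Proof.
move=> mf mg; apply: measurable_sum => i.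
by apply: measurable_funM; apply: (measurableT_comp (measurable_coord i)).
Qed.

Lemma bmeas_sdot2 d (T : measurableType d) (f g : T -> S) :
  measurable_fun setT f -> measurable_fun setT g ->
  bmeas (fun t => sdot (f t) (g t)).
Proof.
move=> mf mg; split; first exact: measurable_sdot.
by exists 1 => t; exact: norm_sdot_le1.
Qed.

End sphere_measurable_maps.

(** * Integrals of norms of translates determine a measure *)

Lemma measurable_sqrt (R : realType) d (T : measurableType d) (f : T -> R) :
  measurable_fun setT f -> measurable_fun setT (fun t => Num.sqrt (f t)).
Proof.
move=> mf; apply: (measurableT_comp _ mf); apply: continuous_measurable_fun.
exact: sqrt_continuous.
Qed.

Section shifted_norm.
Variables (R : realType) (n : nat).
Local Notation S := (sphere R n).
Implicit Types x y : S.

Lemma bmeas_sdot x : bmeas (sdot x).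
Proof.
by apply: bmeas_sdot2; [exact: measurable_cst|exact: measurable_id].
Qed.

(** This is the norm of [\val y + r *: \val x], see [shifted_normE], written as
    a function of the scalar product. *)
Definition shifted_norm x r y : R := Num.sqrt (1 + r ^+ 2 + 2 * r * sdot x y).

Lemma shifted_normE x r y : shifted_norm x r y = enorm (\val y + r *: \val x).
Proof.
rewrite enormE; congr Num.sqrt; rewrite dotDl !dotDr !dotZl !dotZr.
have := sdot_id x; have := sdot_id y; rewrite /sdot => -> ->.
by rewrite (dotC (\val y)); ring.
Qed.

Lemma bmeas_shifted_norm x r : 0 < r < 1 -> bmeas (shifted_norm x r).
Proof.
move=> /andP[r0 r1]; split.
  apply: measurable_sqrt; apply: measurable_funD; first exact: measurable_cst.
  by apply: measurable_funM; [exact: measurable_cst|have [] := bmeas_sdot x].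
exists (Num.sqrt 4) => y; rewrite ger0_norm ?sqrtr_ge0// ler_wsqrtr//.
have /ler_normlP[_ s1] := norm_sdot_le1 x y.
have : r ^+ 2 <= 1 by rewrite expr_le1//; lra.
have : 2 * r * sdot x y <= 2 * r by rewrite ler_piMr//; lra.
lra.
Qed.

End shifted_norm.

Section determination.
Variables (R : realType) (n : nat).
Local Notation S := (sphere R n).
Variables P Q : probability S R.

Hypothesis PQ : forall (x : S) (r : R), 0 < r < 1 ->
  \int[P]_y shifted_norm x r y = \int[Q]_y shifted_norm x r y.

(** The vanishing parameters c = 2r / (1 + r^2) and the antipodes [sopp x] bring
    the hypothesis into the form required by [agree_moment]. *)
Let agree_sdotX (x : S) k : agree P Q (fun y => sdot x y ^+ k).
Proof.
pose r i : R := 2^-1 * harmonic i.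
have r01 i : 0 < r i <= 2^-1.
  rewrite mulr_gt0 ?invr_gt0 ?ltr0n//= ler_piMr ?invr_ge0//.
  by rewrite invf_le1 ?ler1n// ltr0n.
have r0 : r @ \oo --> 0.
  by rewrite -(mulr0 (2^-1)); apply: cvgMr; exact: cvg_harmonic.
pose c i := 2 * r i / (1 + r i ^+ 2).
have den i : 1 <= 1 + r i ^+ 2 by rewrite lerDl sqr_ge0.
have den0 i : 0 < 1 + r i ^+ 2 by rewrite (lt_le_trans _ (den i)).
apply: (@agree_moment _ _ _ _ _ (sdot x) c).
- by move=> y; exact: norm_sdot_le1.
- move=> i; have /andP[ri0 ri1] := r01 i.
  rewrite divr_gt0 ?mulr_gt0//= ler_pdivrMr// mul1r.
  by apply: le_trans (den i); lra.
- rewrite (_ : 0 = 2 * 0 / (1 + 0 ^+ 2) :> R); last by rewrite mulr0 mul0r.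
  apply: cvgM; first exact: cvgMr.
  apply: cvgV; first by rewrite expr0n addr0 oner_neq0.
  by apply: cvgD; [exact: cvg_cst|rewrite expr2; apply: cvgM].
- move=> i; have /andP[ri0 ri1] := r01 i.
  have e y : Num.sqrt (1 - c i * sdot x y) = (Num.sqrt (1 + r i ^+ 2))^-1 *
      shifted_norm (sopp x) (r i) y.
    rewrite /shifted_norm -sqrtrV ?ltW// -sqrtrM ?invr_ge0 ?ltW//.
    congr Num.sqrt; rewrite sdotNl /c; field.
    by rewrite gt_eqF.
  apply: agree_ext (agreeZ (Num.sqrt (1 + r i ^+ 2))^-1 _) => [y|].
    by rewrite e.
  have ri01 : 0 < r i < 1 by rewrite ri0/=; apply: le_lt_trans ri1 _; lra.
  by split; [exact: bmeas_shifted_norm|exact: PQ].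
Qed.

Let agree_dotX (w : 'rV[R]_n.+1) k :
  agree P Q (fun y : S => dot w (\val y) ^+ k).
Proof.
have [w0|w0] := eqVneq (enorm w) 0.
  apply: agree_ext (agree_cst P Q (0 ^+ k)) => y.
  by rewrite (enorm_eq0 w0) dot0l.
apply: agree_ext (agreeZ (enorm w ^+ k) (agree_sdotX (sdir w) k)) => y.
by rewrite -exprMn /sdot -dotZl sdirE.
Qed.

Let agree_exp_dot (w : 'rV[R]_n.+1) :
  agree P Q (fun y : S => expR (dot w (\val y))).
Proof. exact/agree_expR/agree_dotX. Qed.

(** Unlike [agree], this property is stable under multiplication by
    exponentials of linear forms. *)
Let agree_exp (f : S -> R) :=
  forall w, agree P Q (fun y => f y * expR (dot w (\val y))).

(** Powers of a sum of exponentials of affine forms are again such sums, so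
    [agree_expR] applies. *)
Let agree_exp_sum (I : finType) (w : I -> 'rV[R]_n.+1) (c : I -> R) :
  agree P Q (fun y : S => expR (- \sum_i expR (dot (w i) (\val y) + c i))).
Proof.
set g := fun y : S => \sum_i expR (dot (w i) (\val y) + c i).
have gX j : agree_exp (fun y => g y ^+ j).
  elim: j => [|j IH] v.
    by apply: agree_ext (agree_exp_dot v) => y; rewrite expr0 mul1r.
  apply: agree_ext (@agree_sum _ _ _ _ _ _ (index_enum I) predT
      (fun i y => expR (c i) * (g y ^+ j * expR (dot (w i + v) (\val y)))) _).
    move=> y; rewrite exprS [g y * _]mulrC -mulrA [g y * _]mulr_suml mulr_sumr.
    by apply: eq_bigr => i _; rewrite dotDl !expRD; ring.
  by move=> i _; exact/agreeZ/IH.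
apply: (@agree_expR _ _ _ _ _ (fun y => - g y)) => j.
apply: agree_ext (agreeZ ((-1) ^+ j) (gX j 0)) => y.
by rewrite dot0l expR0 mulr1 [RHS]exprNn.
Qed.

(** The functions exp (- sum_i exp (k^2 (y_i - a_i) + k)) tend to the indicator
    of [box a]: where y_i < a_i the i-th term tends to 0, whereas it is at
    least exp k if y_i >= a_i; the summand k settles the case y_i = a_i. Both
    cases are controlled by exp (- k) <= 1 / (k + 1). *)
Let agree_box a : agree P Q (\1_(box a) : S -> R).
Proof.
pose K (k : nat) : R := k%:R.
pose g k (y : S) := \sum_i
   expR (dot (K k ^+ 2 *: delta_mx 0 i) (\val y) + (K k - K k ^+ 2 * a 0 i)).
have gE k y : g k y = \sum_i expR (K k ^+ 2 * (\val y 0 i - a 0 i) + K k).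
  apply: eq_bigr => i _; congr expR; rewrite dotZl.
  rewrite /dot (bigD1 i)//= big1 ?addr0 => [|j /negPf ji]; last first.
    by rewrite mxE ji andbF mul0r.
  by rewrite mxE !eqxx mul1r; ring.
have g0 k y : 0 <= g k y by rewrite sumr_ge0// => i _; exact: expR_ge0.
have expN_le (t : R) k : K k <= t -> expR (- t) <= harmonic k.
  move=> kt; rewrite expRN /harmonic /= lef_pV2 ?posrE ?expR_gt0 ?ltr0n//.
  apply: le_trans (expR_ge1Dx t).
  by rewrite -natr1 addrC lerD2l.
apply: (@agree_lim _ _ _ _ _ (fun k y => expR (- g k y)) _ 1).
- by move=> k; exact: agree_exp_sum.
- by move=> k y; rewrite ger0_norm ?expR_ge0// -expR0 ler_expR oppr_le0.
move=> y.
suff near_bd : \forall k \near \oo,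
    `|\1_(box a) y - expR (- g k y)| <= n.+1%:R * (harmonic k : R).
  apply/cvgrPdist_le => e e0.
  have : n.+1%:R * (harmonic k : R) @[k --> \oo] --> 0.
    by rewrite -(mulr0 (n.+1%:R)); apply: cvgMr; exact: cvg_harmonic.
  move/cvgrPdist_le => /(_ e e0).
  apply: filterS2 near_bd => k; rewrite sub0r normrN => h1 h2.
  by apply: le_trans h1 _; apply: le_trans h2; exact: ler_norm.
have [ya|nya] := pselect (box a y); last first.
  rewrite indicE memNset//.
  have [i yi] : exists i, a 0 i <= \val y 0 i.
    move: nya => /existsNP[i /negP]; rewrite -leNgt => ?; by exists i.
  apply: nearW => k; rewrite sub0r normrN ger0_norm ?expR_ge0//.
  apply: (@le_trans _ _ (harmonic k)); last first.
    by rewrite ler_peMl ?harmonic_ge0// ler1n.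
  apply: expN_le; rewrite gE (bigD1 i)//= -[leLHS]addr0 lerD//; last first.
    by apply: sumr_ge0 => j _; exact: expR_ge0.
  apply: le_trans (_ : 1 + K k <= _); first by rewrite lerDr.
  apply: (le_trans (expR_ge1Dx _)); rewrite ler_expR lerDr.
  by rewrite mulr_ge0 ?sqr_ge0// subr_ge0.
rewrite indicE mem_set// [true%:R]mulr1n.
(* Once k (a_i - y_i) >= 2, the exponent is at most - k. *)
have term_bd i : \forall k \near \oo,
    expR (K k ^+ 2 * (\val y 0 i - a 0 i) + K k) <= harmonic k.
  have d0 : 0 < a 0 i - \val y 0 i by rewrite subr_gt0; exact: ya.
  near=> k.
  have kd : 2 <= K k * (a 0 i - \val y 0 i).
    rewrite -ler_pdivrMr//; near: k; exact: nbhs_infty_ger.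
  rewrite -[X in expR X]opprK; apply: expN_le.
  have := ler0n R k; rewrite -/(K k) => k0.
  have -> : - (K k ^+ 2 * (\val y 0 i - a 0 i) + K k) =
      K k * (K k * (a 0 i - \val y 0 i) - 1) by ring.
  by rewrite ler_peMr//; lra.
have all_bd : \forall k \near \oo, forall i,
    expR (K k ^+ 2 * (\val y 0 i - a 0 i) + K k) <= harmonic k.
  exact: filter_forall.
apply: filterS all_bd => k bd.
have e1 : expR (- g k y) <= 1 by rewrite -expR0 ler_expR oppr_le0.
rewrite ger0_norm ?subr_ge0//.
apply: (@le_trans _ _ (g k y)).
  by have := expR_ge1Dx (- g k y); lra.
rewrite gE; apply: le_trans (ler_sum _ (fun i _ => bd i)) _.
by rewrite sumr_const card_ord mulr_natl.
Unshelve. all: by end_near. Qed.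

Lemma sphere_measure_determined A : measurable A -> P A = Q A.
Proof.
apply: sphere_measure_unique => a.
have mb : measurable (box a : set S).
  by rewrite sphere_measurableE; apply: sub_sigma_algebra; exists a.
have [_] := agree_box a; rewrite /Rintegral !integral_indic// !setIT => e.
by rewrite -(fineK (fin_num_measure P _ mb)) e fineK// fin_num_measure.
Qed.

End determination.

(** * Integrals against images and couplings *)

Section means.
Context d d' {T : measurableType d} {T' : measurableType d'} {R : realType}.

Lemma mean_pushforward (P : probability T R) (P' : probability T' R)
    (phi : T -> T') (f : T' -> R) :
  measurable_fun setT phi ->
  (forall A, measurable A -> P' A = P (phi @^-1` A)) -> bmeas f ->
  \int[P']_y f y = \int[P]_x f (phi x).
Proof.
move=> mphi PP' [mf bf].
pose X : {mfun T >-> T'} :=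
  HB.pack phi (isMeasurableFun.Build _ _ _ _ phi mphi).
rewrite /Rintegral; congr fine.
rewrite (eq_measure_integral (distribution P X)); last first.
  by move=> A mA _; exact: PP'.
rewrite integral_distribution//; first exact/measurable_EFinP.
have [M fM] := bf.
have bfX : bmeas (fun x => f (phi x)).
  by split; [exact: measurableT_comp|exists M => x; exact: fM].
exact: (bmeas_integrable P bfX).
Qed.

End means.

Section mean_lemmas.
Context d {T : measurableType d} {R : realType} (P : probability T R).
Implicit Types f g : T -> R.

Lemma meanD f g : bmeas f -> bmeas g ->
  \int[P]_x (f x + g x) = \int[P]_x f x + \int[P]_x g x.
Proof. by move=> bf bg; rewrite RintegralD//; exact: bmeas_integrable. Qed.

Lemma meanZ a f : bmeas f -> \int[P]_x (a * f x) = a * \int[P]_x f x.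
Proof. by move=> bf; rewrite RintegralZl//; exact: bmeas_integrable. Qed.

Lemma le_mean f g : bmeas f -> bmeas g -> (forall x, f x <= g x) ->
  \int[P]_x f x <= \int[P]_x g x.
Proof.
by move=> bf bg fg; apply: le_Rintegral => //; exact: bmeas_integrable.
Qed.

Lemma mean_ae0 f (N : set T) : bmeas f -> measurable N -> P N = 0%E ->
  (forall x, ~ N x -> f x = 0) -> \int[P]_x f x = 0.
Proof.
move=> [mf _] mN N0 f0; rewrite /Rintegral (ae_eq_integral (cst 0%E))//.
- by rewrite integral0.
- exact/measurable_EFinP.
- exists N; split=> // x /= h; apply: contrapT => /f0 fx.
  by apply: h => _; rewrite fx.
Qed.

Lemma mean_eq0 f : bmeas f -> (forall x, 0 <= f x) -> \int[P]_x f x = 0 ->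
  P [set x | f x != 0] = 0%E.
Proof.
move=> bf f0 i0; have [mf _] := bf.
have : (\int[P]_(x in setT) `|(f x)%:E| = 0)%E.
  under eq_integral do rewrite gee0_abs ?lee_fin//.
  by rewrite bmeas_integralE// i0.
have mE : measurable_fun setT (EFin \o f) by exact/measurable_EFinP.
move=> /(ae_eq_integral_abs P measurableT mE) ae0.
have mN : measurable [set x | f x != 0].
  rewrite (_ : mkset _ = f @^-1` (~` [set 0])).
    rewrite -[X in measurable X]setTI; apply: mf => //.
    by apply: measurableC; exact: measurable_set1.
  by apply/seteqP; split=> x /= /eqP.
apply/negligibleP => //; apply: negligibleS ae0 => x /= /eqP fx h.
by apply: fx; have [] := h I.
Qed.

End mean_lemmas.

(** * Computing with the Wasserstein distance *)

Section transport.
Variables (R : realType) (n : nat).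
Local Notation S := (sphere R n).
Implicit Types (x y : S) (mu nu : borelProb R n).

Definition cost (pi : probability (S * S)%type R) : R :=
  \int[pi]_z (chordal z.1 z.2 ^+ 2).

Lemma bmeas_chordal d (T : measurableType d) (f g : T -> S) :
  measurable_fun setT f -> measurable_fun setT g ->
  bmeas (fun t => chordal (f t) (g t) ^+ 2).
Proof.
move=> mf mg; rewrite (_ : (fun _ => _) = fun t => 2 + -2 * sdot (f t) (g t)).
  apply: bmeasD; first exact: bmeas_cst.
  exact/bmeasZ/bmeas_sdot2.
by apply/funext => t; rewrite chordal_sqr mulNr.
Qed.

Lemma product_coupling mu nu : couplings mu nu (mu \x nu)%E.
Proof.
move=> A mA; split.
  rewrite (_ : _ @^-1` _ = A `*` setT); last first.
    by apply/seteqP; split=> -[a b] /=; [split|case].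
  apply: (etrans (product_measure1E mu nu mA measurableT)).
  by rewrite /= probability_setT mule1.
rewrite (_ : _ @^-1` _ = setT `*` A); last first.
  by apply/seteqP; split=> -[a b] /=; [split|case].
apply: (etrans (product_measure1E mu nu measurableT mA)).
by rewrite /= probability_setT mul1e.
Qed.

Let costs mu nu :=
  [set (\int[pi]_z ((chordal z.1 z.2) ^+ 2)%:E)%E | pi in couplings mu nu].

Let costE (pi : probability (S * S)%type R) :
  (\int[pi]_z ((chordal z.1 z.2) ^+ 2)%:E)%E = (cost pi)%:E.
Proof. by rewrite bmeas_integralE//; exact: bmeas_chordal. Qed.

Let cost_ge0 pi : 0 <= cost pi.
Proof. by apply: Rintegral_ge0 => z _; exact: sqr_ge0. Qed.

Let inf_ge0 mu nu : (0 <= ereal_inf (costs mu nu))%E.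
Proof. by apply: le_ereal_inf_tmp => _ [pi _ <-]; rewrite costE lee_fin. Qed.

Let inf_fin mu nu : ereal_inf (costs mu nu) \is a fin_num.
Proof.
rewrite ge0_fin_numE//; apply: (@le_lt_trans _ _ (cost (mu \x nu)%E)%:E).
  apply: ereal_inf_lbound; exists (mu \x nu)%E; last exact: costE.
  exact: product_coupling.
exact: ltry.
Qed.

Let W2E mu nu : (W2 mu nu ^+ 2)%:E = ereal_inf (costs mu nu).
Proof.
have f0 := fine_ge0 (inf_ge0 mu nu).
by rewrite /W2 sqr_sqrtr; [exact: (fineK (inf_fin mu nu))|exact: f0].
Qed.

Lemma W2_ge0 mu nu : 0 <= W2 mu nu. Proof. exact: sqrtr_ge0. Qed.

Lemma W2_sqr_le mu nu pi : couplings mu nu pi -> W2 mu nu ^+ 2 <= cost pi.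
Proof.
move=> cpi; rewrite -lee_fin W2E -costE.
by apply: ereal_inf_lbound; exists pi.
Qed.

Lemma W2_sqr_ge mu nu c : (forall pi, couplings mu nu pi -> c <= cost pi) ->
  c <= W2 mu nu ^+ 2.
Proof.
move=> h; rewrite -lee_fin W2E; apply: le_ereal_inf_tmp => _ [pi cpi <-].
by rewrite costE lee_fin h.
Qed.

Lemma mean_fst mu nu pi (f : S -> R) : couplings mu nu pi -> bmeas f ->
  \int[mu]_y f y = \int[pi]_z f z.1.
Proof.
move=> cpi bf; apply: mean_pushforward => // A mA.
by have [-> _] := cpi A mA.
Qed.

Lemma mean_snd mu nu pi (f : S -> R) : couplings mu nu pi -> bmeas f ->
  \int[nu]_y f y = \int[pi]_z f z.2.
Proof.
move=> cpi bf; apply: mean_pushforward => // A mA.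
by have [_ ->] := cpi A mA.
Qed.

Definition point_mass x : borelProb R n :=
  borelProb_of (dirac x : probability S R).

Definition push (phi : {mfun S >-> S}) mu : borelProb R n :=
  borelProb_of (distribution mu phi : probability S R).

Lemma mean_point_mass x (f : S -> R) : bmeas f ->
  \int[point_mass x]_y f y = f x.
Proof.
move=> [mf bf]; rewrite /Rintegral (eq_measure_integral (dirac x)).
  rewrite integral_dirac//; first by rewrite diracT mul1e.
  exact/measurable_EFinP.
by move=> A mA _; exact: borelProb_ofE.
Qed.

Lemma mean_push (phi : {mfun S >-> S}) mu (f : S -> R) : bmeas f ->
  \int[push phi mu]_y f y = \int[mu]_y f (phi y).
Proof.
by move=> bf; apply: mean_pushforward => // A mA; exact: borelProb_ofE.
Qed.

(** The image of [mu] by [(f, g)] is a coupling of [nu1] and [nu2]. *)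
Lemma W2_sqr_le_pair mu (f g : S -> S) nu1 nu2 :
  measurable_fun setT f -> measurable_fun setT g ->
  (forall A, measurable A -> nu1 A = mu (f @^-1` A)) ->
  (forall A, measurable A -> nu2 A = mu (g @^-1` A)) ->
  W2 nu1 nu2 ^+ 2 <= \int[mu]_y (chordal (f y) (g y) ^+ 2).
Proof.
move=> mf mg n1 n2.
have mfg : measurable_fun setT (fun y => (f y, g y)).
  exact: measurable_fun_pair.
pose X : {mfun S >-> (S * S)%type} :=
  HB.pack (fun y => (f y, g y)) (isMeasurableFun.Build _ _ _ _ _ mfg).
have cX : couplings nu1 nu2 (distribution mu X).
  by move=> A mA; rewrite n1// n2.
apply: (le_trans (W2_sqr_le cX)); rewrite /cost.
rewrite (mean_pushforward (P := mu) (phi := X))//.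
by apply: bmeas_chordal.
Qed.

Lemma measurable_point x : measurable [set x].
Proof.
rewrite (_ : [set x] = sdot x @^-1` [set 1]); last first.
  by apply/seteqP; split=> y /=; [move->; exact: sdot_id|move/sdot_eq1 ->].
rewrite -[X in measurable X]setTI; apply: measurable_sdot => //.
Qed.

(** Any coupling of [point_mass x] and [nu] is concentrated on the pairs (x, y),
    so all couplings have the same cost. *)
Lemma W2_point_mass x nu :
  W2 (point_mass x) nu ^+ 2 = \int[nu]_y (chordal x y ^+ 2).
Proof.
apply/eqP; rewrite eq_le; apply/andP; split.
  apply: (@W2_sqr_le_pair nu (fun=> x) id) => // A mA.
  rewrite borelProb_ofE//= diracE.
  have [xA|xA] := pselect (A x).
    rewrite mem_set// (_ : _ @^-1` _ = setT) ?probability_setT//.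
    by apply/seteqP; split.
  by rewrite memNset// (_ : _ @^-1` _ = set0) ?measure0//; apply/seteqP; split.
apply: W2_sqr_ge => pi cpi; rewrite (mean_snd cpi); last exact: bmeas_chordal.
have b1 : bmeas (fun z : S * S => chordal z.1 z.2 ^+ 2) by exact: bmeas_chordal.
have b2 : bmeas (fun z : S * S => chordal x z.2 ^+ 2) by exact: bmeas_chordal.
have : \int[pi]_z (chordal z.1 z.2 ^+ 2 + -1 * chordal x z.2 ^+ 2) = 0.
  apply: (@mean_ae0 _ _ _ pi _ (fst @^-1` (~` [set x]))).
  - by apply: bmeasD => //; exact: bmeasZ.
  - rewrite -[X in measurable X]setTI; apply: measurable_fst => //.
    by apply: measurableC; exact: measurable_point.
  - have mx : measurable (~` [set x]).
      by apply: measurableC; exact: measurable_point.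
    have [-> _] := cpi _ mx; rewrite borelProb_ofE//= diracE memNset//.
    by move=> /=; exact.
  - by move=> z /contrapT /= ->; rewrite mulN1r subrr.
rewrite meanD//; last exact: bmeasZ.
by rewrite meanZ// mulN1r => /eqP; rewrite subr_eq0 => /eqP <-.
Qed.

Lemma W2_point_mass2 x y : W2 (point_mass x) (point_mass y) = chordal x y.
Proof.
apply/eqP; rewrite -(eqrXn2 (n := 2))// ?W2_ge0 ?chordal_ge0//.
by rewrite W2_point_mass mean_point_mass//; exact: bmeas_chordal.
Qed.

End transport.

(** * Metric characterisation of point masses *)

Section antipodal.
Variables (R : realType) (n : nat).
Local Notation S := (sphere R n).
Implicit Types (x y : S) (mu nu : borelProb R n).

Lemma point_mass_inj : injective (@point_mass R n).
Proof.
move=> x y xy; apply: sdot_eq1.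
have := chordal_sqr x y; rewrite -W2_point_mass2 xy W2_point_mass2.
by rewrite chordal_sqr sdot_id; lra.
Qed.

Lemma W2_antipode x : W2 (point_mass x) (point_mass (sopp x)) = 2.
Proof.
apply/eqP; rewrite W2_point_mass2 -(eqrXn2 (n := 2))// ?chordal_ge0//.
by rewrite chordal_sqr sdotC sdotNl sdot_id; apply/eqP; ring.
Qed.

(** The product coupling costs at least 4, hence is concentrated on the pairs
    with scalar product -1. By the definition of the product measure, some
    section of the complement is negligible: for some x, the measure [nu] is
    concentrated at the antipode of x. *)
Lemma W2_eq2_point_mass mu nu : W2 mu nu = 2 -> exists y, nu = point_mass y.
Proof.
move=> w2.
have bs : bmeas (fun z : S * S => sdot z.1 z.2) by exact: bmeas_sdot2.
have bf : bmeas (fun z : S * S => 2 + 2 * sdot z.1 z.2).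
  by apply: bmeasD; [exact: bmeas_cst|exact: bmeasZ].
pose P : probability (S * S)%type R := (mu \x nu)%E.
have i0 : \int[P]_z (2 + 2 * sdot z.1 z.2) = 0.
  apply/eqP; rewrite eq_le Rintegral_ge0 ?andbT; last first.
    by move=> z _; have /ler_normlP[? ?] := norm_sdot_le1 z.1 z.2; lra.
  have := W2_sqr_le (@product_coupling R n mu nu); rewrite w2 -/P /cost.
  have -> : (fun z : S * S => chordal z.1 z.2 ^+ 2) =
            (fun z => 4 + -1 * (2 + 2 * sdot z.1 z.2)).
    by apply/funext => z; rewrite chordal_sqr; ring.
  rewrite meanD; [|exact: bmeas_cst|exact: bmeasZ].
  by rewrite meanZ// mean_cst; lra.
have f0 (z : S * S) : 0 <= 2 + 2 * sdot z.1 z.2.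
  by have /ler_normlP[? ?] := norm_sdot_le1 z.1 z.2; lra.
have PN := mean_eq0 bf f0 i0.
set N := [set z | _] in PN.
have mN : measurable N.
  rewrite (_ : N = (fun z => 2 + 2 * sdot z.1 z.2) @^-1` (~` [set 0])).
    rewrite -[X in measurable X]setTI; apply: (bf.1) => //.
    by apply: measurableC; exact: measurable_set1.
  by apply/seteqP; split=> x /= /eqP.
have [x xN] : exists x, nu (xsection N x) = 0%E.
  apply: contrapT => /forallNP nN.
  have : (\int[mu]_(x in setT) `|nu (xsection N x)| = 0)%E.
    under eq_integral do rewrite gee0_abs ?measure_ge0//.
    exact: PN.
  move/(ae_eq_integral_abs mu measurableT (measurable_fun_xsection nu mN)).
  move=> [A [mA A0 sA]].
  have AT : A = setT.
    by apply/seteqP; split=> // x _; apply: sA => /= /(_ I); exact: nN.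
  have := probability_setT mu; rewrite -AT A0 => /eqP.
  by rewrite eq_sym onee_eq0.
exists (sopp x); apply: borelProb_ext => A mA.
rewrite borelProb_ofE//= diracE.
have far B : measurable B -> ~ B (sopp x) -> nu B = 0%E.
  move=> mB Bx; apply: (@subset_measure0 _ _ _ nu _ (xsection N x)) => //.
    exact: measurable_xsection.
  move=> y By; rewrite xsectionE /N /=.
  apply/negP => /eqP xy; apply: Bx.
  have /sdot_eqN1 <- // : sdot x y = -1 by lra.
have [Ax|Ax] := pselect (A (sopp x)); last by rewrite memNset// far.
have AC : nu (~` A) = 0%E by apply: far => //; exact: measurableC.
have := probability_setC nu mA; rewrite mem_set// AC => /esym/eqP.
by rewrite sube_eq// ?fin_num_measure// add0e => /eqP <-.
Qed.

End antipodal.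

(** * Minimising weighted sums of squared distances *)

Section weighted_distances.
Variables (R : realType) (n : nat).
Local Notation S := (sphere R n).
Implicit Types (x y : S) (mu eta : borelProb R n).

Let chordal_sum x r y z : chordal y z ^+ 2 + r * chordal x z ^+ 2 =
  2 + 2 * r - 2 * dot (\val y + r *: \val x) (\val z).
Proof. by rewrite !chordal_sqr dotDl dotZl /sdot; ring. Qed.

(** Integrate [chordal_sum] against an arbitrary coupling of [mu] and [eta], and
    bound the scalar product by [dot_le_enorm]. *)
Lemma weighted_W2_ge x r mu eta : 0 < r < 1 ->
  2 + 2 * r - 2 * \int[mu]_y shifted_norm x r y <=
  W2 mu eta ^+ 2 + r * W2 (point_mass x) eta ^+ 2.
Proof.
move=> r01; rewrite -lerBlDr; apply: W2_sqr_ge => pi cpi.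
rewrite lerBlDr W2_point_mass (mean_snd cpi); last exact: bmeas_chordal.
have be := bmeas_shifted_norm x r01.
rewrite (mean_fst cpi)// /cost.
have be1 : bmeas (fun z : S * S => shifted_norm x r z.1).
  split; first by apply: measurableT_comp => //; have [] := be.
  by have [_ [M eM]] := be; exists M => z; exact: eM.
have b1 : bmeas (fun z : S * S => chordal z.1 z.2 ^+ 2) by exact: bmeas_chordal.
have b2 : bmeas (fun z : S * S => chordal x z.2 ^+ 2) by exact: bmeas_chordal.
rewrite -(meanZ pi r b2) -meanD//; last exact: bmeasZ.
rewrite -mulNr -(meanZ pi _ be1) -[X in X + _](mean_cst pi).
rewrite -meanD//; first last.
- exact: bmeasZ.
- exact: bmeas_cst.
apply: le_mean => [||z].
- by apply: bmeasD; [exact: bmeas_cst|exact: bmeasZ].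
- by apply: bmeasD => //; exact: bmeasZ.
rewrite chordal_sum shifted_normE.
by have := dot_le_enorm (\val z.1 + r *: \val x) z.2; lra.
Qed.

(** The minimiser is the image of [mu] by the map sending y to the direction of
    y + r x; as r < 1, this vector never vanishes. *)
Lemma weighted_W2_attained x r mu : 0 < r < 1 ->
  exists eta, W2 mu eta ^+ 2 + r * W2 (point_mass x) eta ^+ 2 <=
    2 + 2 * r - 2 * \int[mu]_y shifted_norm x r y.
Proof.
move=> r01; have /andP[r0 r1] := r01.
pose f (y : S) := sdir (\val y + r *: \val x).
have e0 y : enorm (\val y + r *: \val x) != 0.
  rewrite -shifted_normE gt_eqF// sqrtr_gt0.
  have /ler_normlP[s1 _] := norm_sdot_le1 x y.
  have : - (2 * r) <= 2 * r * sdot x y by rewrite -mulrN1 ler_wpM2l//; lra.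
  have : 0 < (1 - r) ^+ 2 by rewrite exprn_gt0// subr_gt0.
  by rewrite sqrrB; lra.
have mf : measurable_fun setT f.
  apply: measurable_fun_sphere => i.
  (* Measurability of the inverse comes from that of powers. *)
  rewrite (_ : (fun _ => _) = fun y : S =>
      (\val y 0 i + r * \val x 0 i) * (shifted_norm x r y `^ (-1))).
    apply: measurable_funM.
      apply: measurable_funD; last exact: measurable_cst.
      exact: measurable_coord.
    have me := (bmeas_shifted_norm x r01).1.
    apply: (measurableT_comp (f := fun e => e `^ (-1)) _ me).
    exact: measurable_powR.
  apply/funext => y; rewrite powR_inv1 ?sqrtr_ge0// shifted_normE.
  have /rowP/(_ i) := sdirE (e0 y); rewrite !mxE => <-.
  by rewrite mulrAC divff// mul1r.
pose F : {mfun S >-> S} := HB.pack f (isMeasurableFun.Build _ _ _ _ _ mf).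
exists (push F mu).
have w1 : W2 mu (push F mu) ^+ 2 <= \int[mu]_y (chordal y (f y) ^+ 2).
  apply: (@W2_sqr_le_pair _ _ mu id f) => // A mA; first exact: borelProb_ofE.
have b1 : bmeas (fun y => chordal y (f y) ^+ 2) by exact: bmeas_chordal.
have b2 : bmeas (fun y => chordal x (f y) ^+ 2) by exact: bmeas_chordal.
have be := bmeas_shifted_norm x r01.
rewrite W2_point_mass mean_push; last exact: bmeas_chordal.
apply: (le_trans (lerD w1 (lexx _))).
rewrite -(meanZ mu r b2) -meanD//; last exact: bmeasZ.
rewrite -mulNr -(meanZ mu _ be) -[X in _ <= X + _](mean_cst mu).
rewrite -meanD//; first last.
- exact: bmeasZ.
- exact: bmeas_cst.
apply: le_mean => [||y].
- by apply: bmeasD => //; exact: bmeasZ.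
- by apply: bmeasD; [exact: bmeas_cst|exact: bmeasZ].
rewrite /= chordal_sum shifted_normE.
rewrite -{1}(sdirE (e0 y)) dotZl -/(sdot _ _) sdot_id; lra.
Qed.

End weighted_distances.

(** * Isometric rigidity *)

Theorem theorem1p1 (R : realType) (n : nat) (hn : (0 < n)%N)
    (Psi : borelProb R n -> borelProb R n)
    (hPsi : is_isometry (@W2 R n) Psi) :
  exists psi : sphere R n -> sphere R n,
    is_isometry (@chordal R n) psi /\
    forall (mu : borelProb R n) (A : set (sphere R n)),
      measurable A -> Psi mu A = pushforward mu psi A.
Proof.
have [surj iso] := hPsi.
have /boolp.choice[psi psiE] x : exists y, Psi (point_mass x) = point_mass y.
  apply: (@W2_eq2_point_mass _ _ (Psi (point_mass (sopp x)))).
  by rewrite iso -[in X in W2 _ X](soppK x) W2_antipode.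
have psi_iso x y : chordal (psi x) (psi y) = chordal x y.
  by rewrite -!W2_point_mass2 -!psiE iso.
have psi_sdot x y : sdot (psi x) (psi y) = sdot x y.
  by have := chordal_sqr x y; rewrite -psi_iso chordal_sqr; lra.
have psi_surj y : exists x, psi x = y.
  have [mu Emu] := surj (point_mass y).
  have [mu' Emu'] := surj (point_mass (sopp y)).
  have /W2_eq2_point_mass[x mux] : W2 mu' mu = 2.
    by rewrite -iso Emu Emu' -[in X in W2 _ X](soppK y) W2_antipode.
  by exists x; apply: point_mass_inj; rewrite -psiE -mux.
exists psi; split=> // mu A mA.
(* The i-th basis vector is some psi x, so the i-th coordinate of psi y is
   <psi x, psi y> = <x, y>. *)
have mpsi : measurable_fun setT psi.
  apply: measurable_fun_sphere => i.
  have e1 : enorm (delta_mx 0 i : 'rV[R]_n.+1) = 1.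
    rewrite /enorm (bigD1 i)//= big1 => [|j /negPf ji].
      by rewrite mxE !eqxx expr1n addr0 sqrtr1.
    by rewrite mxE ji andbF expr0n.
  have [x xi] := psi_surj (sdir (delta_mx 0 i)).
  rewrite (_ : (fun _ => _) = sdot x); first exact: (bmeas_sdot x).1.
  apply/funext => y; rewrite -psi_sdot xi /sdot.
  have -> : \val (sdir (delta_mx 0 i : 'rV[R]_n.+1)) = delta_mx 0 i.
    have := @sdirE R n (delta_mx 0 i).
    by rewrite e1 scale1r => ->//; exact: oner_neq0.
  rewrite /dot (bigD1 i)//= big1 ?addr0 => [|j /negPf ji].
    by rewrite mxE !eqxx mul1r.
  by rewrite mxE ji andbF mul0r.
pose F : {mfun sphere R n >-> sphere R n} :=
  HB.pack psi (isMeasurableFun.Build _ _ _ _ _ mpsi).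
have Wpsi x eta : W2 (point_mass (psi x)) (Psi eta) = W2 (point_mass x) eta.
  by rewrite -psiE iso.
apply: (@sphere_measure_determined R n (Psi mu) (distribution mu F)) => //.
move=> z r r01.
have [x <-] := psi_surj z.
have be := bmeas_shifted_norm (psi x) r01.
transitivity (\int[mu]_y shifted_norm x r y); last first.
  rewrite (mean_pushforward (P := mu) (phi := psi)
    (f := shifted_norm (psi x) r))//.
  by apply: eq_Rintegral => y _; rewrite /shifted_norm psi_sdot.
(* Each minimum bounds the other, as Psi transports competitors both ways. *)
apply/eqP; rewrite eq_le; apply/andP; split.
  have [eta'] := weighted_W2_attained (psi x) (Psi mu) r01.
  have [eta <-] := surj eta'; rewrite iso Wpsi.
  by have := weighted_W2_ge x mu eta r01; rewrite /shifted_norm; lra.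
have [eta] := weighted_W2_attained x mu r01.
rewrite -iso -Wpsi; have := weighted_W2_ge (psi x) (Psi mu) (Psi eta) r01.
by rewrite /shifted_norm; lra.
Qed.
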